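(* Let $d\ge 1$ and let $P\subset\mathbb{R}^d$ be a $d$-dimensional perfect prismoid. Then there exists a $0/1$-polytope obtained from the $d$-dimensional unit cube, i.e. a polytope of the form $\operatorname{conv}(S)$ with $S\subseteq\{0,1\}^d$, that is affinely equivalent to $P$.
   Context: Polytopes are convex polytopes (convex hulls of finite point sets) in Euclidean space $\mathbb{R}^d$; a $d$-dimensional polytope in $\mathbb{R}^d$ is one whose affine hull is all of $\mathbb{R}^d$. For $X\subset\mathbb{R}^d$, $\operatorname{lin}X$ denotes the linear space associated with the affine hull of $X$, i.e. the set of all combinations $a_1x_1+\dots+a_nx_n$ with $x_i\in X$, $a_i\in\mathbb{R}$ and $a_1+\dots+a_n=0$. A facet of a $d$-dimensional polytope is a $(d-1)$-dimensional face. Let $F$ be a facet of a polytope $P$. $P$ is called a prismoid over $F$ if there is a face $F'$ of $P$ with $\operatorname{lin}F'\subseteq\operatorname{lin}F$ and $P=\operatorname{conv}(F\cup F')$ (the face $F'$ may have smaller dimension than $F$). $P$ is called a perfect prismoid if it is a prismoid over each of its facets. A polytope is called a $0/1$-polytope if it is the convex hull of some subset of the vertex set of a unit cube. Two polytopes in $\mathbb{R}^d$ are affinely equivalent if there is an invertible affine transformation of $\mathbb{R}^d$ mapping one onto the other. *)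

(* Defs.v *)
From mathcomp Require Import all_boot all_order all_algebra.
From mathcomp Require Import boolp classical_sets cardinality reals.

Set Implicit Arguments.
Unset Strict Implicit.
Unset Printing Implicit Defensive.

Import Order.TTheory GRing.Theory Num.Theory.
Local Open Scope classical_set_scope.
Local Open Scope ring_scope.

Definition conv_hull (R : realType) (d : nat) (X : set 'rV[R]_d) :
    set 'rV[R]_d :=
  [set v | exists n (a : 'I_n -> R) (x : 'I_n -> 'rV[R]_d),
    [/\ forall i, X (x i), forall i, 0 <= a i, \sum_(i < n) a i = 1 &
        v = \sum_(i < n) a i *: x i]].

Definition aff_hull (R : realType) (d : nat) (X : set 'rV[R]_d) :
    set 'rV[R]_d :=
  [set v | exists n (a : 'I_n -> R) (x : 'I_n -> 'rV[R]_d),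
    [/\ forall i, X (x i), \sum_(i < n) a i = 1 &
        v = \sum_(i < n) a i *: x i]].

Definition lin (R : realType) (d : nat) (X : set 'rV[R]_d) : set 'rV[R]_d :=
  [set v | exists n (a : 'I_n -> R) (x : 'I_n -> 'rV[R]_d),
    [/\ forall i, X (x i), \sum_(i < n) a i = 0 &
        v = \sum_(i < n) a i *: x i]].

(* The empty set has no dimension here, although [lin set0 = [set 0]]. *)
Definition has_dim (R : realType) (d : nat) (X : set 'rV[R]_d) (k : nat) :
    Prop :=
  X !=set0 /\
  exists U : {vspace 'rV[R]_d}, lin X = [set v | v \in U] /\ \dim U = k.

Definition polytope (R : realType) (d : nat) (P : set 'rV[R]_d) : Prop :=
  exists X : set 'rV[R]_d, finite_set X /\ P = conv_hull X.

(* Taking [c = 0] gives the two improper faces, [P] (for [b = 0]) and [set0]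
   (for [b > 0]). *)
Definition face (R : realType) (d : nat) (P F : set 'rV[R]_d) : Prop :=
  exists (c : 'rV[R]_d) (b : R),
    (forall x, P x -> \sum_(i < d) c 0 i * x 0 i <= b) /\
    F = [set x | P x /\ \sum_(i < d) c 0 i * x 0 i = b].

Definition facet (R : realType) (d : nat) (P F : set 'rV[R]_d) : Prop :=
  face P F /\ exists k, has_dim P k.+1 /\ has_dim F k.

Definition prismoid_over (R : realType) (d : nat) (P F : set 'rV[R]_d) :
    Prop :=
  exists F' : set 'rV[R]_d,
    [/\ face P F', lin F' `<=` lin F & P = conv_hull (F `|` F')].

Definition perfect_prismoid (R : realType) (d : nat) (P : set 'rV[R]_d) :
    Prop :=
  polytope P /\ forall F, facet P F -> prismoid_over P F.

Definition unit_cube_vertices (R : realType) (d : nat) : set 'rV[R]_d :=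
  [set x | forall i, x 0 i = 0 \/ x 0 i = 1].

(* Points are row vectors, so the linear part acts by right multiplication. *)
Definition affinely_equivalent (R : realType) (d : nat)
    (P Q : set 'rV[R]_d) : Prop :=
  exists (A : 'M[R]_d) (t : 'rV[R]_d),
    A \in unitmx /\ [set x *m A + t | x in P] = Q.

(* Main.v *)
Require Import Defs.
From mathcomp Require Import all_boot all_order all_algebra.
From mathcomp Require Import boolp classical_sets cardinality reals.

Set Implicit Arguments.
Unset Strict Implicit.
Unset Printing Implicit Defensive.

Import Order.TTheory GRing.Theory Num.Theory.
Local Open Scope classical_set_scope.
Local Open Scope ring_scope.

(** A perfect prismoid is a two-level polytope with respect to the normal of
each of its facets, and these normals span the space.

Let P be the convex hull of an irredundant finite family p.  If the facet F
lies in the hyperplane c.x = b, the prismoid property gives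
P = conv (F u F') with lin F' inside lin F, so that c is constant on F' as
well.  Every p i is an extreme point of P (irredundant_extreme), hence lies in
F or in F', and c takes only two values on the family p
(prismoid_two_values).  These values differ because P is full-dimensional.

The facet normals span: every nonzero u has a positive scalar product with
some facet normal (facet_normal).  With m the barycentre of p, such
a normal is a c with c.(p i - m) <= 1 for all i and c.u > 0 that has as many
tight constraints as possible (tight_normal).

Hence d linearly independent normals can be chosen
(independent_functionals).  Rescaled and shifted to take the values 0 and 1 on
p, they are the coordinates of an affine isomorphism that sends p into the
vertex set of the unit cube. *)

(** * Scalar products and level sets *)

Definition dot (R : realType) d (c x : 'rV[R]_d) : R :=
  \sum_(i < d) c 0 i * x 0 i.

Lemma dotE (R : realType) d (c x : 'rV[R]_d) : dot c x = (x *m c^T) 0 0.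
Proof. by rewrite mxE; apply: eq_bigr => i _; rewrite mxE mulrC. Qed.

Lemma dotC (R : realType) d (c x : 'rV[R]_d) : dot c x = dot x c.
Proof. by apply: eq_bigr => i _; rewrite mulrC. Qed.

Lemma dotDr (R : realType) d (c x y : 'rV[R]_d) :
  dot c (x + y) = dot c x + dot c y.
Proof. by rewrite !dotE mulmxDl mxE. Qed.

Lemma dotZr (R : realType) d (c x : 'rV[R]_d) a : dot c (a *: x) = a * dot c x.
Proof. by rewrite !dotE -scalemxAl mxE. Qed.

Lemma dotBr (R : realType) d (c x y : 'rV[R]_d) :
  dot c (x - y) = dot c x - dot c y.
Proof. by rewrite -scaleN1r dotDr dotZr mulN1r. Qed.

Lemma dotDl (R : realType) d (x y c : 'rV[R]_d) :
  dot (x + y) c = dot x c + dot y c.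
Proof. by rewrite !(dotC _ c) dotDr. Qed.

Lemma dotZl (R : realType) d (x c : 'rV[R]_d) a : dot (a *: x) c = a * dot x c.
Proof. by rewrite !(dotC _ c) dotZr. Qed.

Lemma dot_sumr (R : realType) d (c : 'rV[R]_d) n (x : 'I_n -> 'rV[R]_d) :
  dot c (\sum_i x i) = \sum_i dot c (x i).
Proof.
by rewrite dotE mulmx_suml summxE; apply: eq_bigr => i _; rewrite dotE.
Qed.

Lemma dot_comb (R : realType) d (c : 'rV[R]_d) n (a : 'I_n -> R)
    (x : 'I_n -> 'rV[R]_d) :
  dot c (\sum_i a i *: x i) = \sum_i a i * dot c (x i).
Proof. by rewrite dot_sumr; apply: eq_bigr => i _; rewrite dotZr. Qed.

Lemma dot_gt0 (R : realType) d (c : 'rV[R]_d) : c != 0 -> 0 < dot c c.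
Proof.
move=> c0; rewrite lt_def sumr_ge0 ?andbT => [|i _]; last by rewrite -expr2 sqr_ge0.
apply: contra c0 => /eqP c0; apply/eqP/rowP => i; rewrite mxE; apply/eqP.
rewrite -sqrf_eq0 expr2; apply/eqP; move: (c0) i isT; apply: psumr_eq0P.
by move=> i _; rewrite -expr2 sqr_ge0.
Qed.

Lemma affine_level (R : realType) d (c : 'rV[R]_d) b n (a : 'I_n -> R)
    (x : 'I_n -> 'rV[R]_d) :
  (forall i, dot c (x i) = b) -> dot c (\sum_i a i *: x i) = (\sum_i a i) * b.
Proof.
by move=> cx; rewrite dot_comb mulr_suml; apply: eq_bigr => i _; rewrite cx.
Qed.

Lemma lin_level (R : realType) d (X : set 'rV[R]_d) (c : 'rV[R]_d) b v :
  (forall x, X x -> dot c x = b) -> lin X v -> dot c v = 0.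
Proof.
move=> cX [n [a [x [Xx a0 ->]]]].
by rewrite (affine_level (b := b)) ?a0 ?mul0r // => i; exact: cX.
Qed.

Lemma conv_level (R : realType) d (X : set 'rV[R]_d) (c : 'rV[R]_d) b v :
  (forall x, X x -> dot c x = b) -> conv_hull X v -> dot c v = b.
Proof.
move=> cX [n [a [x [Xx _ a1 ->]]]].
by rewrite (affine_level (b := b)) ?a1 ?mul1r // => i; exact: cX.
Qed.

(** The level c.x = b propagates from X to its affine hull, that is, to the
whole space; comparing the points c and 0 gives c.c = 0. *)
Lemma full_level_eq0 (R : realType) d (X : set 'rV[R]_d) (c : 'rV[R]_d) b :
  aff_hull X = setT -> (forall x, X x -> dot c x = b) -> c = 0.
Proof.
move=> Xfull cX; have cb v : dot c v = b.
  have : aff_hull X v by rewrite Xfull.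
  move=> [n [a [x [Xx a1 ->]]]].
  by rewrite (affine_level (b := b)) ?a1 ?mul1r // => i; exact: cX.
apply/eqP/negPn/negP => /dot_gt0; rewrite cb -(cb 0) -(scale0r 0) dotZr mul0r.
by rewrite ltxx.
Qed.

(** * Irredundant generators of a polytope *)

(** Collecting the weights of repeated points, a convex combination of points
of a finite family has one weight per index. *)
Lemma conv_rangeP (R : realType) d n (p : 'I_n -> 'rV[R]_d) v :
  conv_hull (range p) v <->
  exists a : 'I_n -> R,
    [/\ forall i, 0 <= a i, \sum_i a i = 1 & v = \sum_i a i *: p i].
Proof.
split=> [[m [a [x [px a0 a1 ->]]]]|[a [a0 a1 ->]]]; last first.
  by exists n, a, p; split=> // i; exists i.
have /choice[f fE] : forall k, exists i, p i = x k.
  by move=> k; have [i _ <-] := px k; exists i.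
exists (fun i => \sum_(k | f k == i) a k); split=> [i||].
- by apply: sumr_ge0 => k _; exact: a0.
- by rewrite -a1 [RHS](partition_big f xpredT).
- rewrite [LHS](partition_big f xpredT) //; apply: eq_bigr => i _.
  by rewrite scaler_suml; apply: eq_bigr => k /eqP <-; rewrite fE.
Qed.

Lemma mem_conv (R : realType) d (X : set 'rV[R]_d) v : X v -> conv_hull X v.
Proof.
move=> Xv; exists 1%N, (fun=> 1), (fun=> v).
by split=> //; rewrite big_ord1 ?scale1r.
Qed.

Lemma comb_weights (R : realType) m n (a : 'I_m -> R) (b : 'I_m -> 'I_n -> R) :
  (forall k, \sum_j b k j = 1) ->
  \sum_j \sum_k a k * b k j = \sum_k a k.
Proof.
move=> b1; rewrite exchange_big; apply: eq_bigr => k _ /=.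
by rewrite -mulr_sumr b1 mulr1.
Qed.

Lemma comb_comb (R : realType) d m n (a : 'I_m -> R) (b : 'I_m -> 'I_n -> R)
    (p : 'I_n -> 'rV[R]_d) :
  \sum_k a k *: (\sum_j b k j *: p j) =
  \sum_j (\sum_k a k * b k j) *: p j.
Proof.
under [RHS]eq_bigr do rewrite scaler_suml.
rewrite [RHS]exchange_big; apply: eq_bigr => k _ /=; rewrite scaler_sumr.
by apply: eq_bigr => j _; rewrite scalerA.
Qed.

Lemma conv_range_sub (R : realType) d n (p : 'I_n -> 'rV[R]_d)
    (X : set 'rV[R]_d) :
  X `<=` conv_hull (range p) -> conv_hull X `<=` conv_hull (range p).
Proof.
move=> Xp v [m [a [y [Xy a0 a1 ->]]]]; apply/conv_rangeP.
have [b bE] := choice (fun k => (conv_rangeP p (y k)).1 (Xp _ (Xy k))).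
exists (fun j => \sum_k a k * b k j); split=> [j||].
- by apply: sumr_ge0 => k _; apply: mulr_ge0 => //; have [] := bE k.
- by rewrite comb_weights // => k; have [] := bE k.
- by rewrite -comb_comb; apply: eq_bigr => k _; have [_ _ <-] := bE k.
Qed.

(** Irredundance is expressed with weights on the whole index type that vanish
at i, which avoids reindexing the family without its i-th member.  It also
forces p to be injective. *)
Definition irredundant (R : realType) d n (p : 'I_n -> 'rV[R]_d) : Prop :=
  forall (i : 'I_n) (a : 'I_n -> R),
    (forall j, 0 <= a j) -> \sum_j a j = 1 -> a i = 0 ->
    p i <> \sum_j a j *: p j.

(** A redundant member can be dropped without changing the convex hull, and
this stops since the family is finite. *)
Lemma irredundant_generators (R : realType) d (P : set 'rV[R]_d) :
  polytope P -> exists n (p : 'I_n -> 'rV[R]_d),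
    P = conv_hull (range p) /\ irredundant p.
Proof.
move=> [X [/finite_seqP[s ->] ->]].
have -> : [set` s] = range (tnth (in_tuple s)).
  apply/seteqP; split=> x /=; last by move=> [i _ <-]; exact: mem_tnth.
  by move=> xs; have /tnthP[i ->] : x \in in_tuple s by []; exists i.
move: (size s) (tnth _) => {s X}; elim=> [|n IHn] p.
  by exists 0%N, p; split=> // -[].
have [pirr|] := pselect (irredundant p); first by exists n.+1, p.
move=> /existsNP[i /existsNP[a]].
rewrite !not_implyE => -[a0 [a1 [ai [pE _]]]].
have [m [q [qE qirr]]] := IHn (p \o lift i).
exists m, q; split=> //; rewrite -qE; apply/seteqP; split; last first.
  apply: conv_range_sub => _ [j _ <-]; exact: mem_conv.
apply: conv_range_sub => _ [j _ <-]; case: (unliftP i j) => [k ->|->].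
  by apply: mem_conv; exists k.
apply/conv_rangeP; exists (a \o lift i); split=> [k||].
- exact: a0.
- by rewrite -a1 (bigD1_ord i) //= ai add0r.
- by rewrite pE (bigD1_ord i) //= ai scale0r add0r.
Qed.

(** Write p i as a convex combination of points y k of A, and each y k in terms
of p; let mu i be the total weight of p i.  If mu i <> 1, solving for p i
writes it in terms of the other members, against irredundance.  If mu i = 1,
any y k that occurs with a nonzero weight has all its weight on p i, so it is
equal to p i. *)
Lemma irredundant_extreme (R : realType) d n (p : 'I_n -> 'rV[R]_d)
    (A : set 'rV[R]_d) i :
  irredundant p -> A `<=` conv_hull (range p) -> conv_hull A (p i) -> A (p i).
Proof.
move=> pirr Ap [m [a [y [Ay a0 a1 pE]]]].
have [b bE] := choice (fun k => (conv_rangeP p (y k)).1 (Ap _ (Ay k))).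
have b0 k j : 0 <= b k j by have [] := bE k.
have b1 k : \sum_j b k j = 1 by have [] := bE k.
pose mu j := \sum_k a k * b k j.
have mu0 j : 0 <= mu j by apply: sumr_ge0 => k _; apply: mulr_ge0.
have mu1 : \sum_j mu j = 1 by rewrite comb_weights.
have pmu : p i = \sum_j mu j *: p j.
  by rewrite pE -comb_comb; apply: eq_bigr => k _; have [_ _ <-] := bE k.
have mu1' := mu1; rewrite (bigD1 i) //= in mu1'.
have [mui|mui] := eqVneq (mu i) 1; last first.
  (* Solving p i = mu i *: p i + ... for p i. *)
  exfalso; have nz : 1 - mu i != 0 by rewrite subr_eq0 eq_sym.
  have sE : \sum_(j | j != i) mu j = 1 - mu i.
    by apply/esym/eqP; rewrite subr_eq addrC mu1'.
  pose c j := if j == i then 0 else (1 - mu i)^-1 * mu j.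
  apply: (pirr i c) => [j|||].
  - rewrite /c; case: ifP => // _; apply: mulr_ge0 => //.
    by rewrite invr_ge0 -sE; apply: sumr_ge0.
  - rewrite (bigD1 i) //= {1}/c eqxx add0r -[RHS](mulVf nz) -[X in _ * X]sE mulr_sumr.
    by apply: eq_bigr => j /negPf ji; rewrite /c ji.
  - by rewrite /c eqxx.
  - rewrite (bigD1 i) //= {1}/c eqxx scale0r add0r.
    have -> : \sum_(j | j != i) c j *: p j =
        (1 - mu i)^-1 *: \sum_(j | j != i) mu j *: p j.
      rewrite scaler_sumr; apply: eq_bigr => j /negPf ji.
      by rewrite /c ji scalerA.
    have -> : \sum_(j | j != i) mu j *: p j = (1 - mu i) *: p i.
      apply/esym/eqP; rewrite scalerBl scale1r subr_eq addrC.
      by rewrite [X in X == _]pmu (bigD1 i).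
    by rewrite scalerA mulVf // scale1r.
have b_le1 k : b k i <= 1.
  by rewrite -(b1 k) (bigD1 i) //= lerDl sumr_ge0.
have ab0 k : a k * (1 - b k i) = 0.
  have S0 : \sum_k a k * (1 - b k i) = 0.
    under eq_bigr do rewrite mulrBr mulr1.
    by rewrite sumrB a1 -/(mu i) mui subrr.
  move: S0 k isT; apply: psumr_eq0P => k _.
  by apply: mulr_ge0 => //; rewrite subr_ge0.
have [k ak] : exists k, a k != 0.
  apply: contrapT => /forallNP ak; have := oner_neq0 R.
  by rewrite -a1 big1 ?eqxx // => k _; apply/eqP/negPn/negP; exact: ak.
have bki : b k i = 1.
  by move/eqP: (ab0 k); rewrite mulf_eq0 (negPf ak) subr_eq0 => /eqP.
suff <- : y k = p i by [].
have [_ _ ->] := bE k; rewrite (bigD1 i) //= bki scale1r big1 ?addr0 // => j ji.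
have S0 : \sum_(j | j != i) b k j = 0.
  by have := b1 k; rewrite (bigD1 i) //= bki => /eqP; rewrite eq_sym addrC -subr_eq subrr => /eqP <-.
by rewrite (psumr_eq0P _ S0) ?scale0r.
Qed.

(** * Facet normals of a full-dimensional polytope *)

(** Vectors whose annihilator is trivial are generators: the matrix whose rows
are the selected vectors, and 0 at the other indices, has full row space. *)
Lemma spanI (R : realType) d n (q : 'I_n -> 'rV[R]_d) (T : pred 'I_n) v :
  (forall w, (forall i, T i -> dot w (q i) = 0) -> w = 0) ->
  exists a : 'I_n -> R, v = \sum_(i | T i) a i *: q i.
Proof.
move=> q0; pose M := \matrix_i (if T i then q i else 0).
have MT : row_full M.
  rewrite /row_full -mxrank_tr; apply: inj_row_free => w wM.
  apply: q0 => i Ti; rewrite dotC dotE.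
  have -> : q i = row i M by rewrite rowK Ti.
  by rewrite tr_row colE mulmxA wM mul0mx mxE.
have /submxP[a ->] := submx_full v MT.
exists (fun i => a 0 i); rewrite mulmx_sum_row [RHS]big_mkcond /=.
by apply: eq_bigr => i _; rewrite rowK; case: (T i); rewrite ?scaler0.
Qed.

(** Among the c with c.q i <= 1 for all i and c.u > 0 (a small multiple of u is
one), take one with the largest number of tight constraints c.q i = 1.  If
some w <> 0 were orthogonal to all tight q i, its sign could be chosen with
w.u >= 0, and moving from c in the direction w would keep all tight
constraints and c.u > 0.  Since the q i sum to 0 and have trivial annihilator,
some w.q i is positive, so the move reaches a new tight constraint, a
contradiction. *)
Lemma tight_normal (R : realType) d n (q : 'I_n -> 'rV[R]_d) u :
  \sum_i q i = 0 -> (forall w, (forall i, dot w (q i) = 0) -> w = 0) ->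
  u != 0 ->
  exists c, [/\ forall i, dot c (q i) <= 1, 0 < dot c u &
    forall w, (forall i, dot c (q i) == 1 -> dot w (q i) = 0) -> w = 0].
Proof.
move=> q_sum q_span u0.
pose feasible c := (forall i, dot c (q i) <= 1) /\ 0 < dot c u.
pose tight c := [pred i | dot c (q i) == 1].
pose good k := `[< exists2 c, feasible c & #|tight c| = k >].
have good0 : exists k, good k.
  pose s := 1 + \sum_i `|dot u (q i)|.
  have s0 : 0 < s by apply: ltr_pwDl => //; exact: sumr_ge0.
  exists #|tight (s^-1 *: u)|; apply/asboolP; exists (s^-1 *: u) => //.
  split=> [i|]; rewrite dotZl; last by rewrite mulr_gt0 ?invr_gt0 ?dot_gt0.
  rewrite mulrC ler_pdivrMr // mul1r (le_trans (ler_norm _)) // /s.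
  rewrite (bigD1 i) //= addrCA lerDl addr_ge0 //.
  exact: sumr_ge0.
have good_le k : good k -> (k <= n)%N.
  by move=> /asboolP[c _ <-]; rewrite -[leqRHS](card_ord n) max_card.
case: (ex_maxnP good0 good_le) => k /asboolP[c [c1 cu] ck] kmax.
exists c; split=> // w0 w0T; apply/eqP/negPn/negP => w0_neq0.
have [w [w_neq0 wT wu]] : exists w, [/\ w != 0,
    (forall i, dot c (q i) == 1 -> dot w (q i) = 0) & 0 <= dot w u].
  have [h|/ltW h] := leP 0 (dot w0 u); first by exists w0.
  exists (- w0); rewrite oppr_eq0 -scaleN1r; split=> // [i /w0T h0|].
    by rewrite dotZl h0 mulr0.
  by rewrite dotZl mulN1r oppr_ge0.
have [i0 wi0] : exists i, 0 < dot w (q i).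
  apply: contrapT => /forallNP wneg; move/negP: w_neq0; apply; apply/eqP.
  apply: q_span => i.
  have wle j : 0 <= - dot w (q j) by rewrite oppr_ge0 leNgt; apply/negP/wneg.
  have : \sum_j - dot w (q j) = 0.
    by rewrite sumrN -dot_sumr q_sum -(scale0r 0) dotZr mul0r oppr0.
  move=> /psumr_eq0P H; apply/eqP; rewrite -oppr_eq0; apply/eqP.
  by apply: H.
(* The step along w at which the i-th constraint becomes tight. *)
pose ratio i := (1 - dot c (q i)) / dot w (q i).
case: (arg_minP (P := fun i => 0 < dot w (q i)) ratio wi0) => i wi rmin.
have r0 : 0 <= ratio i by rewrite divr_ge0 ?subr_ge0 // ltW.
pose c' := c + ratio i *: w.
have c'E j : dot c' (q j) = dot c (q j) + ratio i * dot w (q j).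
  by rewrite dotDl dotZl.
have c'feas : feasible c'.
  split=> [j|]; last first.
    by rewrite dotDl dotZl ltr_wpDr // mulr_ge0.
  rewrite c'E; have [wj|wj] := leP (dot w (q j)) 0.
    by rewrite (le_trans _ (c1 j)) // gerDl mulr_ge0_le0.
  by rewrite addrC -lerBrDr -ler_pdivlMr // rmin.
have : (#|tight c'| <= k)%N by apply: kmax; apply/asboolP; exists c'.
rewrite leqNgt -ck proper_card //; apply/properP; split.
  apply/fintype.subsetP => j; rewrite !inE => cj.
  by rewrite c'E (wT _ cj) mulr0 addr0.
exists i; rewrite !inE; first by rewrite c'E /ratio divfK ?(gt_eqF wi) // addrC subrK.
by apply/negP => /wT wi_eq0; rewrite wi_eq0 ltxx in wi.
Qed.

Lemma has_dim_hyperplane (R : realType) d (X : set 'rV[R]_d.+1) c :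
  c != 0 -> X !=set0 -> lin X = [set v | dot c v = 0] -> has_dim X d.
Proof.
move=> c0 X0 XE; split=> //.
pose f : 'Hom('rV[R]_d.+1, 'M[R]_1) := linfun (mulmxr c^T).
have fE v : (f v == 0) = (dot c v == 0).
  rewrite lfunE /= dotE; apply/eqP/eqP => [->|h]; first by rewrite mxE.
  by apply/matrixP => i j; rewrite !ord1 h mxE.
exists (lker f); split.
  by rewrite XE; apply/seteqP; split=> v /=; rewrite memv_ker fE => /eqP.
have := limg_ker_dim f fullv; rewrite capfv dimvf dim_matrix mul1r.
suff -> : \dim (f @: fullv) = 1%N by rewrite addn1 => -[].
apply/eqP; rewrite eqn_leq; apply/andP; split.
  by rewrite (leq_trans (dimvS (subvf _))) // dimvf dim_matrix mul1r.
rewrite lt0n dimv_eq0; apply/negP => /eqP img0.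
have : f c \in (f @: fullv)%VS by rewrite memv_img ?memvf.
by rewrite img0 memv0 fE gt_eqF // dot_gt0.
Qed.

Lemma aff_full_neq0 (R : realType) d (P : set 'rV[R]_d) :
  aff_hull P = setT -> P !=set0.
Proof.
move=> Pfull; have : aff_hull P 0 by rewrite Pfull.
move=> [[|n] [a [x [Px a1 _]]]]; last by exists (x ord0).
by move/eqP: a1; rewrite big_ord0 eq_sym oner_eq0.
Qed.

(** A vector v is the difference of the affine combinations that represent v
and 0, hence a combination with weights of sum 0. *)
Lemma has_dim_full (R : realType) d (P : set 'rV[R]_d) :
  aff_hull P = setT -> has_dim P d.
Proof.
move=> Pfull; split; first exact: aff_full_neq0.
exists fullv; rewrite dimvf dim_matrix mul1r; split=> //.
apply/seteqP; split=> v _ /=; first exact: memvf.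
have : aff_hull P v /\ aff_hull P 0 by rewrite Pfull.
move=> [[n [a [x [Px a1 vE]]]] [m [b [y [Py b1 zE]]]]].
exists (n + m)%N,
  (fun k => match split k with inl i => a i | inr j => - b j end),
  (fun k => match split k with inl i => x i | inr j => y j end).
split=> [k||]; first by case: (split k).
- rewrite big_split_ord /=.
  under eq_bigr do rewrite (unsplitK (inl _)).
  under [X in _ + X]eq_bigr do rewrite (unsplitK (inr _)).
  by rewrite sumrN a1 b1 subrr.
- rewrite big_split_ord /=.
  under eq_bigr do rewrite (unsplitK (inl _)).
  under [X in _ + X]eq_bigr do rewrite (unsplitK (inr _)) scaleNr.
  by rewrite sumrN -vE -zE subr0.
Qed.

Lemma conv_le (R : realType) d (X : set 'rV[R]_d) (c : 'rV[R]_d) b v :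
  (forall x, X x -> dot c x <= b) -> conv_hull X v -> dot c v <= b.
Proof.
move=> cX [n [a [x [Xx a0 a1 ->]]]].
rewrite dot_comb -[b]mul1r -a1 mulr_suml; apply: ler_sum => i _.
by apply: ler_wpM2l => //; exact: cX.
Qed.

(** With the barycentre m of p as origin, tight_normal gives c such that the
tight vectors p i - m span the space.  The face F cut out by c is then a
facet: if c.v = 0, write v as a combination of the tight p i - m; applying c
shows that the coefficients sum to 0, so m cancels and v is in lin F. *)
Lemma facet_normal (R : realType) d n (p : 'I_n -> 'rV[R]_d.+1)
    (P : set 'rV[R]_d.+1) u :
  P = conv_hull (range p) -> aff_hull P = setT -> u != 0 ->
  exists c b, 0 < dot c u /\ facet P [set x | P x /\ dot c x = b].
Proof.
move=> PE Pfull u0.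
have Pp i : P (p i) by rewrite PE; apply: mem_conv; exists i.
have n0 : n%:R != 0 :> R.
  rewrite pnatr_eq0 -lt0n; have [x] := aff_full_neq0 Pfull.
  by rewrite PE => -[[|m] [a [y [py _ a1 _]]]];
    [move/eqP: a1; rewrite big_ord0 eq_sym oner_eq0
    |have [i _ _] := py ord0; case: (n) i => // -[]].
pose m := n%:R^-1 *: \sum_i p i.
pose q i := p i - m.
have q_sum : \sum_i q i = 0.
  by rewrite sumrB sumr_const card_ord -scaler_nat scalerA mulfV // scale1r subrr.
have q_span w : (forall i, dot w (q i) = 0) -> w = 0.
  move=> wq; apply: (full_level_eq0 (b := dot w m) Pfull) => x.
  rewrite PE; apply: conv_level => _ [i _ <-].
  by apply/eqP; rewrite -subr_eq0 -dotBr wq.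
have [c [c1 cu cT]] := tight_normal q_sum q_span u0.
have c0 : c != 0 by apply: contraTneq cu => ->; rewrite -(scale0r 0) dotZl mul0r ltxx.
pose b := 1 + dot c m.
have cb x : P x -> dot c x <= b.
  rewrite PE; apply: conv_le => _ [i _ <-].
  by rewrite /b -lerBlDr -dotBr; exact: c1.
have tightF i : dot c (q i) == 1 -> dot c (p i) = b.
  by rewrite dotBr subr_eq => /eqP.
exists c, b; split=> //; split; first by exists c, b.
exists d; split; first exact: has_dim_full.
have [i0 ti0] : exists i, dot c (q i) == 1.
  apply: contrapT => /forallNP cq; move/negP: c0; apply; apply/eqP/cT => i.
  by move=> ti; case: (cq i).
apply: (has_dim_hyperplane c0); first by exists (p i0) => /=; split; [exact: Pp|exact: tightF].
apply/seteqP; split=> v /=; first by apply: (lin_level (b := b)) => x [].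
move=> cv; have [a vE] := spanI v cT.
have a0 : \sum_(i | dot c (q i) == 1) a i = 0.
  rewrite -[RHS]cv vE dotE mulmx_suml summxE; apply: eq_bigr => i /eqP qi.
  by rewrite -dotE dotZr qi mulr1.
(* Indices that are not tight get weight 0 and a tight point i0. *)
exists n, (fun i => if dot c (q i) == 1 then a i else 0),
  (fun i => if dot c (q i) == 1 then p i else p i0).
split=> [i||].
- by case: ifP => [ti|_] /=; split; [exact: Pp|exact: tightF|exact: Pp|exact: tightF].
- by rewrite -big_mkcond.
- transitivity (\sum_(i | dot c (q i) == 1) a i *: p i).
    under [RHS]eq_bigr do rewrite -[p _](subrK m) scalerDr.
    by rewrite big_split /= -scaler_suml a0 scale0r addr0.
  by rewrite big_mkcond; apply: eq_bigr => i _; case: ifP; rewrite ?scale0r.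
Qed.

(** * Cube coordinates *)

(** The second value b' is the value of c at any point of F'.  Such a point
exists and b' <> b, since otherwise c would be constant on P. *)
Lemma prismoid_two_values (R : realType) d n (p : 'I_n -> 'rV[R]_d)
    (P : set 'rV[R]_d) c b :
  P = conv_hull (range p) -> irredundant p -> aff_hull P = setT -> c != 0 ->
  prismoid_over P [set x | P x /\ dot c x = b] ->
  exists2 b', b' != b & forall i, dot c (p i) = b \/ dot c (p i) = b'.
Proof.
move=> PE pirr Pfull c0 [F' [F'face linF' PF]].
set F := [set x | _] in linF' PF.
have Pnconst : ~ (forall x, (F `|` F') x -> dot c x = b).
  move=> cb; move/eqP: c0; apply; apply: (full_level_eq0 (b := b) Pfull) => x.
  by rewrite PF; exact: conv_level.
have [y0 F'y0] : F' !=set0.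
  apply: contrapT => F'0; apply: Pnconst => x [[]//|F'x].
  by case: F'0; exists x.
have F'const y : F' y -> dot c y = dot c y0.
  move=> F'y; apply/eqP; rewrite -subr_eq0 -dotBr; apply/eqP.
  apply: (lin_level (X := F) (b := b)); first by move=> x [].
  apply: linF'; exists 2%N, (fun i => if i == 0 then 1 else -1),
    (fun i => if i == 0 then y else y0); split=> [i||].
  - by case: ifP.
  - by rewrite !big_ord_recl big_ord0 /= addr0 subrr.
  - by rewrite !big_ord_recl big_ord0 /= addr0 scale1r scaleN1r.
exists (dot c y0) => [|i].
  apply/eqP => y0b; apply: Pnconst => x [[]//|F'x].
  by rewrite F'const.
have : (F `|` F') (p i).
  apply: (irredundant_extreme pirr).
    rewrite -PE => x [[]//|]; case: F'face => c' [b' [_ ->]] [] //.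
  by rewrite -PF PE; apply: mem_conv; exists i.
by case=> [[_]|/F'const]; [left|right].
Qed.

Definition two_level (R : realType) d n (p : 'I_n -> 'rV[R]_d) (c : 'rV[R]_d) :
    Prop :=
  exists t, forall i, dot c (p i) = t \/ dot c (p i) = t + 1.

Lemma two_level_normal (R : realType) d n (p : 'I_n -> 'rV[R]_d.+1)
    (P : set 'rV[R]_d.+1) u :
  P = conv_hull (range p) -> irredundant p -> aff_hull P = setT ->
  perfect_prismoid P -> u != 0 -> exists2 c, two_level p c & dot c u != 0.
Proof.
move=> PE pirr Pfull [_ Pprism] u0.
have [c [b [cu /Pprism Fprism]]] := facet_normal PE Pfull u0.
have c0 : c != 0.
  by apply: contraTneq cu => ->; rewrite -(scale0r 0) dotZl mul0r ltxx.
have [b' b'b cp] := prismoid_two_values PE pirr Pfull c0 Fprism.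
have bb' : b - b' != 0 by rewrite subr_eq0 eq_sym.
exists ((b - b')^-1 *: c); last first.
  by rewrite dotZl mulf_neq0 ?invr_eq0 // gt_eqF.
exists ((b - b')^-1 * b') => i; rewrite dotZl.
have [->|->] := cp i; [right|by left].
by rewrite -[1](mulVf bb') -mulrDr [b' + _]addrC subrK.
Qed.

(** As long as k < d, some u <> 0 is orthogonal to the k rows chosen so far; a
functional c with property Q and c.u <> 0 is independent of them. *)
Lemma independent_functionals (R : realType) d (Q : 'rV[R]_d -> Prop) k :
  (forall u, u != 0 -> exists2 c, Q c & dot c u != 0) -> (k <= d)%N ->
  exists2 C : 'M[R]_(k, d), row_free C & forall i, Q (row i C).
Proof.
move=> Qsep; elim: k => [|k IHk] kd.
  by exists 0 => [|[]//]; rewrite /row_free mxrank0.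
have [C Cfree CQ] := IHk (ltnW kd).
have kerC : kermx C^T != 0.
  by rewrite kermx_eq0 /row_free mxrank_tr (eqP Cfree) ltn_eqF.
have [u u0 uC] : exists2 u : 'rV_d, u != 0 & C *m u^T = 0.
  exists (nz_row (kermx C^T)); rewrite ?nz_row_eq0 //.
  apply: trmx_inj; rewrite trmx_mul trmxK trmx0.
  by apply/sub_kermxP; exact: nz_row_sub.
have [c Qc cu] := Qsep u u0.
have cCfree : row_free (col_mx c C).
  apply: inj_row_free => w; rewrite -[w]hsubmxK mul_row_col.
  set a := lsubmx w; set v := rsubmx w => wC.
  have a0 : a = 0.
    (* Pairing the relation a *: c + v *m C = 0 with u leaves a * c.u = 0. *)
    have /(congr1 (mulmx^~ u^T)) := wC.
    rewrite mulmxDl -!mulmxA uC mulmx0 addr0 mul0mx => /matrixP/(_ 0 0).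
    rewrite [a]mx11_scalar mul_scalar_mx mxE [RHS]mxE -dotE dotC => /eqP.
    by rewrite mulf_eq0 (negPf cu) orbF => /eqP ->; rewrite raddf0.
  move: wC; rewrite a0 mul0mx add0r => vC.
  by rewrite (row_free_inj Cfree (etrans vC (esym (mul0mx _ _)))) row_mx0.
have cCQ (i : 'I_(1 + k)) : Q (row i (col_mx c C)).
  case: (split_ordP i) => j ->; last by rewrite rowKd.
  by rewrite rowKu ord1 (_ : row 0 c = c) //; apply/rowP => l; rewrite mxE.
by exists (col_mx c C).
Qed.

Lemma conv_image_affine (R : realType) d (A : 'M[R]_d) t (X : set 'rV[R]_d) :
  [set x *m A + t | x in conv_hull X] =
  conv_hull [set x *m A + t | x in X].
Proof.
have affE n (a : 'I_n -> R) (x : 'I_n -> 'rV[R]_d) : \sum_i a i = 1 ->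
    (\sum_i a i *: x i) *m A + t = \sum_i a i *: (x i *m A + t).
  move=> a1; under [RHS]eq_bigr do rewrite scalerDr.
  rewrite big_split /= -scaler_suml a1 scale1r mulmx_suml; congr (_ + _).
  by apply: eq_bigr => i _; rewrite scalemxAl.
apply/seteqP; split=> v.
  move=> [_ [n [a [x [Xx a0 a1 ->]]]] <-].
  exists n, a, (fun i => x i *m A + t); split=> // [i|]; last exact: affE.
  by exists (x i).
move=> [n [a [y [Xy a0 a1 ->]]]].
have /choice[x xE] : forall i, exists x, X x /\ x *m A + t = y i.
  by move=> i; have [x Xx xy] := Xy i; exists x.
exists (\sum_i a i *: x i).
  by exists n, a, x; split=> // i; have [] := xE i.
by rewrite affE //; apply: eq_bigr => i _; have [_ ->] := xE i.
Qed.

Theorem mainTheorem1 (R : realType) (d : nat) (d_ge1 : (1 <= d)%N)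
    (P : set 'rV[R]_d) (P_full : aff_hull P = setT)
    (P_perfect : perfect_prismoid P) :
  exists S : set 'rV[R]_d,
    S `<=` @unit_cube_vertices R d /\ affinely_equivalent (conv_hull S) P.
Proof.
case: d d_ge1 P P_full P_perfect => // d _ P P_full P_perfect.
have [n [p [PE pirr]]] := irredundant_generators P_perfect.1.
have [C Cfree Clevel] := independent_functionals
  (fun u => two_level_normal PE pirr P_full P_perfect) (leqnn d.+1).
have CU : C^T \in unitmx by rewrite unitmx_tr -row_free_unit.
have [t tE] := choice Clevel.
pose T := \row_i t i.
pose g x := x *m C^T - T.
exists (range (g \o p)); split.
  move=> _ [j _ <-] i /=.
  have -> : g (p j) 0 i = dot (row i C) (p j) - t i.
    rewrite !mxE; congr (_ - _).
    by apply: eq_bigr => l _; rewrite !mxE mulrC.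
  by have [->|->] := tE i j; [left|right]; rewrite ?subrr // addrC addKr.
exists (invmx C^T), (T *m invmx C^T); split; first by rewrite unitmx_inv.
rewrite conv_image_affine PE image_comp; congr conv_hull.
apply: eq_imagel => j _ /=.
by rewrite -mulmxDl subrK mulmxK.
Qed.
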